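(* Consider a stochastic hybrid system with a single discrete mode and state $(x,y)\in\mathbb{R}^{n+L}$ that is polynomial: its drift $F(x,y)$, diffusion coefficient $G(x,y)$, reset intensities $\lambda_r(x,y)$ and reset maps $\phi_r(x,y)$, $r=1,\dots,\mathcal{R}$, are polynomials in $(x,y)$. Suppose its state satisfies, at all times, algebraic constraints of the form $$l_b\le a_n(x,y)\le u_b,\qquad a_p(x,y)=0,$$ where $a_n$ and $a_p$ are vectors of polynomials and $l_b,u_b$ are constant vectors. Let $d\in\mathbb{N}$ and let $\mathcal{X}$ be the vector of all moments of $(x,y)$ of order at most $d$. Then there are a finite vector $\bar{\mathcal{X}}$ of moments of $(x,y)$ of order higher than $d$ and constant matrices $A,B,C_p,D_p$ such that $$\frac{d\mathcal{X}}{dt}=A\mathcal{X}+B\bar{\mathcal{X}},\qquad 0=C_p\mathcal{X}+D_p\bar{\mathcal{X}},$$ where the second equation represents the linear relations among the moments in $\mathcal{X}$ and $\bar{\mathcal{X}}$ that are obtained by multiplying the entries of the constraint $a_p(x,y)=0$ by monomials in $(x,y)$ and taking expectations.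
   Context: Such a system arises from a single-mode, possibly non-polynomial SHS with state $x\in\mathbb{R}^n$ by appending additional states $y\in\mathbb{R}^L$ (functions of $x$, e.g. $y=1/J(x)$ with $J$ a common denominator), so that the dynamics become polynomial in $(x,y)$ at the expense of algebraic constraints relating $x$ and $y$. The single-mode SHS with state $z=(x,y)$ evolves between resets by $dz=F(z)\,dt+G(z)\,dw$, where $w$ is a $k$-dimensional Wiener process. Reset $r$ occurs with state-dependent intensity $\lambda_r(z)\ge 0$ and changes the state from $z$ to $\phi_r(z)\in\mathbb{R}^{n+L}$. A moment of $(x,y)$ is an expectation $\mathbb{E}(x_1^{m_1}\cdots x_n^{m_n}y_1^{m_{n+1}}\cdots y_L^{m_{n+L}})$ with $m\in\mathbb{N}^{n+L}$ ($\mathbb{N}$ includes $0$); its order is $\sum_i m_i$. The zeroth-order moment $\mathbb{E}(1)=1$ is included in $\mathcal{X}$. Standing convention: all moments are finite, and for polynomial test functions $\psi$ the moments evolve by the extended generator, $\frac{d}{dt}\mathbb{E}[\psi(z)]=\mathbb{E}[(\mathcal{L}\psi)(z)]$ with $$(\mathcal{L}\psi)(z)=\frac{\partial\psi}{\partial z}F(z)+\tfrac12\operatorname{Trace}\Big(\frac{\partial^2\psi}{\partial z^2}G(z)G(z)^\top\Big)+\sum_{r=1}^{\mathcal{R}}\big(\psi(\phi_r(z))-\psi(z)\big)\lambda_r(z).$$ *)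

(* Defs.v *)
(* The notations of mpoly are not imported because
   they clash with those of MathComp-Analysis:
     multinom N = 'X_{1..N}, bmultinom N b = 'X_{1..N < b},
     mpoly N R = {mpoly R[N]}, mpolyX R m = 'X_[m]. *)
From HB Require Import structures.
From mathcomp Require Import all_boot all_order all_algebra.
From mathcomp Require Import all_classical all_reals all_analysis.
From mathcomp Require Import -(notations) mpoly.

Set Implicit Arguments.
Unset Strict Implicit.
Unset Printing Implicit Defensive.

Import Order.TTheory GRing.Theory Num.Theory.
Import numFieldNormedType.Exports.

Local Open Scope classical_set_scope.
Local Open Scope ring_scope.

Definition mono_fun (R : realType) (N : nat) (m : multinom N)
    (z : 'cV[R]_N) : R := \prod_(i < N) z i 0 ^+ m i.

Definition poly_fun (R : realType) (N : nat) (p : mpoly N R)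
    (z : 'cV[R]_N) : R := meval (fun i => z i 0) p.

Definition is_poly_fun (R : realType) (N : nat) (f : 'cV[R]_N -> R) : Prop :=
  exists p : mpoly N R, f = poly_fun p.

(* Single-mode stochastic hybrid system on R^N driven by a k-dimensional
   Wiener process, with nr resets:
     dz = drift z dt + diffusion z dw,
     z |-> reset r z with intensity (intensity r z). *)
Record SHS (R : realType) (N k nr : nat) := MkSHS {
  drift : 'cV[R]_N -> 'cV[R]_N;
  diffusion : 'cV[R]_N -> 'M[R]_(N, k);
  intensity : 'I_nr -> 'cV[R]_N -> R;
  reset : 'I_nr -> 'cV[R]_N -> 'cV[R]_N
}.

Definition polynomial_SHS (R : realType) (N k nr : nat)
    (S : SHS R N k nr) : Prop :=
  [/\ forall i, is_poly_fun (fun z => drift S z i 0),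
      forall i j, is_poly_fun (fun z => diffusion S z i j),
      forall r, is_poly_fun (intensity S r)
    & forall r i, is_poly_fun (fun z => reset S r z i 0)].

Definition partial (R : realType) (N : nat) (i : 'I_N) (f : 'cV[R]_N -> R)
    (z : 'cV[R]_N) : R := 'D_(delta_mx i 0) f z.

Definition gradient (R : realType) (N : nat) (f : 'cV[R]_N -> R)
    (z : 'cV[R]_N) : 'rV[R]_N := \row_i partial i f z.

Definition hessian (R : realType) (N : nat) (f : 'cV[R]_N -> R)
    (z : 'cV[R]_N) : 'M[R]_N := \matrix_(i, j) partial i (partial j f) z.

Definition generator (R : realType) (N k nr : nat) (S : SHS R N k nr)
    (psi : 'cV[R]_N -> R) (z : 'cV[R]_N) : R :=
  (gradient psi z *m drift S z) 0 0
  + 2^-1 * \tr (hessian psi z *m (diffusion S z *m (diffusion S z)^T))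
  + \sum_(r < nr) (psi (reset S r z) - psi z) * intensity S r z.

(* f has derivative l at time t, relative to the time domain [0, +oo[:
   two-sided at t > 0, right-sided at t = 0. *)
Definition time_derivative (R : realType) (f : R -> R) (t l : R) : Prop :=
  h^-1 * (f (t + h) - f t) @[h --> within [set h | 0 <= t + h] 0^'] --> l.

(* Real-valued expectation; only used for integrable f. *)
Definition expect (R : realType) (dT : measure_display)
    (T : measurableType dT) (P : probability T R) (f : T -> R) : R :=
  fine ('E_P[f])%E.

(* All moments are finite, and the expectation of every polynomial test
   function evolves by the extended generator of S.  The stochastic differential
   equation and the resets enter only through this generator. *)
Definition state_process (R : realType) (N k nr : nat) (S : SHS R N k nr)
    (dT : measure_display) (T : measurableType dT) (P : probability T R)
    (z : R -> T -> 'cV[R]_N) : Prop :=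
  [/\ forall t, 0 <= t -> forall i, measurable_fun setT (fun w => z t w i 0),
      forall t, 0 <= t -> forall m : multinom N,
        P.-integrable setT (fun w => (mono_fun m (z t w))%:E)
    & forall (psi : mpoly N R) t, 0 <= t ->
        time_derivative (fun s => expect P (fun w => poly_fun psi (z s w))) t
          (expect P (fun w => generator S (poly_fun psi) (z t w)))].

Definition satisfies_constraints (R : realType) (N qn qp : nat)
    (a_n : 'cV[mpoly N R]_qn) (l_b u_b : 'cV[R]_qn)
    (a_p : 'cV[mpoly N R]_qp) (z : 'cV[R]_N) : Prop :=
  (forall i, l_b i 0 <= poly_fun (a_n i 0) z <= u_b i 0) /\
  (forall j, poly_fun (a_p j 0) z = 0).

Definition moment (R : realType) (N : nat) (dT : measure_display)
    (T : measurableType dT) (P : probability T R) (z : R -> T -> 'cV[R]_N)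
    (m : multinom N) (t : R) : R :=
  expect P (fun w => mono_fun m (z t w)).

(* Exponents of degree < d.+1, i.e. of order at most d. *)
Definition low_dim (N d : nat) : nat := #|{: bmultinom N d.+1}|.

Definition low_exp (N d : nat) (i : 'I_(low_dim N d)) : multinom N :=
  enum_val i.

Definition low_moments (R : realType) (N d : nat) (dT : measure_display)
    (T : measurableType dT) (P : probability T R) (z : R -> T -> 'cV[R]_N)
    (t : R) : 'cV[R]_(low_dim N d) :=
  \col_i moment P z (low_exp i) t.

Definition moments_of (R : realType) (N q : nat)
    (mbar : q.-tuple (multinom N)) (dT : measure_display)
    (T : measurableType dT) (P : probability T R) (z : R -> T -> 'cV[R]_N)
    (t : R) : 'cV[R]_q :=
  \col_i moment P z (tnth mbar i) t.

Definition constraint_multiple (R : realType) (N qp : nat)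
    (a_p : 'cV[mpoly N R]_qp) (j : 'I_qp) (m : multinom N) :
    mpoly N R :=
  a_p j 0 * mpolyX R m.

(* The expectation of p involves only moments of order at most d and moments
   listed in mbar. *)
Definition expressible (R : realType) (N d q : nat)
    (mbar : q.-tuple (multinom N)) (p : mpoly N R) : Prop :=
  forall m, m \in msupp p -> (mdeg m <= d)%N \/ m \in mbar.

(* The polynomial whose formal expectation (each monomial replaced by the
   corresponding moment) is the i-th row of C X + D Xbar. *)
Definition row_poly (R : realType) (N d q c : nat)
    (mbar : q.-tuple (multinom N))
    (C : 'M[R]_(c, low_dim N d)) (D : 'M[R]_(c, q)) (i : 'I_c) :
    mpoly N R :=
  \sum_(a < low_dim N d) C i a *: mpolyX R (low_exp a)
  + \sum_(b < q) D i b *: mpolyX R (tnth mbar b).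

(* The rows of 0 = C X + D Xbar are exactly the relations E[a_p z^m] = 0 whose
   moments all lie in X and Xbar.  The last clause says that Xbar is large
   enough for every relation in which a moment of X occurs, so that these
   relations are not lost by taking Xbar too small. *)
Definition represents_relations (R : realType) (N d q c qp : nat)
    (a_p : 'cV[mpoly N R]_qp) (mbar : q.-tuple (multinom N))
    (C : 'M[R]_(c, low_dim N d)) (D : 'M[R]_(c, q)) : Prop :=
  [/\ forall i, exists j m, row_poly mbar C D i = constraint_multiple a_p j m,
      forall j m, expressible d mbar (constraint_multiple a_p j m) ->
        exists i, row_poly mbar C D i = constraint_multiple a_p j m
    & forall j m,
        has (fun m' => mdeg m' <= d)%N
            (msupp (constraint_multiple a_p j m)) ->
        expressible d mbar (constraint_multiple a_p j m)].

(* Main.v *)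
Require Import Defs.
From mathcomp Require Import all_boot all_order all_algebra.
From mathcomp Require Import all_classical all_reals all_analysis.
From mathcomp Require Import -(notations) mpoly.

Set Implicit Arguments.
Unset Strict Implicit.
Unset Printing Implicit Defensive.

Import Order.TTheory GRing.Theory Num.Theory.
Import numFieldNormedType.Exports.

Local Open Scope classical_set_scope.
Local Open Scope ring_scope.

(** The extended generator maps polynomials to polynomials: partial derivatives
    of a polynomial function are polynomial functions, composition with a
    polynomial reset map stays polynomial, and products and sums with the
    polynomial data of the system do too ([generator_poly_fun]).  Applied to
    each monomial of degree at most [d], it yields a polynomial [g a] with
    d/dt E[z^a] = E[g_a(z)].  The expectation is linear on polynomials because
    all moments are integrable, so the right-hand side is a linear combination
    of moments, whose coefficients are those of [g a] ([expect_row_poly],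
    [row_poly_coefs]).  They are the entries of the matrices A and B.

    The moment list consists of all monomials of degree in (d, D] for one large
    bound D.  Then a polynomial is expressible as soon as its degree is at most
    D.  The bound is at least the degree of every [g a], and at least d plus the
    degree of every entry of the constraint [a_p].  The latter makes every
    relation that involves a low moment expressible: a multiple a_p z^m has a
    monomial of degree at most d only if m has degree at most d.
    Conversely, an expressible nonzero multiple has m of degree at most D, so
    the expressible relations form a finite set and can be listed as the rows of
    the matrices Cp and Dp ([represents_relations_exists]).  Each row vanishes
    on the moments because a_p(z) z^m is almost surely zero. *)

(** * Closure properties of polynomial functions *)

Lemma mono_funE (R : realType) N (m : multinom N) :
  mono_fun m = poly_fun (mpolyX R m).
Proof. by apply/funext => z; rewrite /poly_fun mevalX. Qed.

Lemma is_poly_fun_poly_fun (R : realType) N (p : mpoly N R) :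
  is_poly_fun (poly_fun p).
Proof. by exists p. Qed.

Lemma is_poly_fun_cst (R : realType) N (c : R) :
  is_poly_fun (fun _ : 'cV[R]_N => c).
Proof. by exists (mpolyC N c); apply/funext => z; rewrite /poly_fun mevalC. Qed.

Lemma is_poly_funD (R : realType) N (f g : 'cV[R]_N -> R) :
  is_poly_fun f -> is_poly_fun g -> is_poly_fun (fun z => f z + g z).
Proof.
move=> [p ->] [q ->]; exists (p + q); apply/funext => z.
by rewrite /poly_fun mevalD.
Qed.

Lemma is_poly_funM (R : realType) N (f g : 'cV[R]_N -> R) :
  is_poly_fun f -> is_poly_fun g -> is_poly_fun (fun z => f z * g z).
Proof.
move=> [p ->] [q ->]; exists (p * q); apply/funext => z.
by rewrite /poly_fun mevalM.
Qed.

Lemma is_poly_funB (R : realType) N (f g : 'cV[R]_N -> R) :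
  is_poly_fun f -> is_poly_fun g -> is_poly_fun (fun z => f z - g z).
Proof.
move=> [p ->] [q ->]; exists (p - q); apply/funext => z.
by rewrite /poly_fun mevalB.
Qed.

Lemma is_poly_fun_sum (R : realType) N (I : Type) (s : seq I)
    (f : I -> 'cV[R]_N -> R) :
  (forall i, is_poly_fun (f i)) -> is_poly_fun (fun z => \sum_(i <- s) f i z).
Proof.
move=> fP; pose p i := sval (cid (fP i)).
exists (\sum_(i <- s) p i); apply/funext => z.
rewrite /poly_fun raddf_sum; apply: eq_bigr => i _.
by rewrite /p; case: cid => /= q /(congr1 (@^~ z)).
Qed.

Lemma is_poly_fun_comp (R : realType) N (p : mpoly N R)
    (phi : 'cV[R]_N -> 'cV[R]_N) :
  (forall i, is_poly_fun (fun z => phi z i 0)) ->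
  is_poly_fun (fun z => poly_fun p (phi z)).
Proof.
move=> phiP; pose q i := sval (cid (phiP i)).
exists (comp_mpoly [tuple q i | i < N] p); apply/funext => z.
rewrite /poly_fun comp_mpoly_meval; apply: meval_eq => i.
by rewrite tnth_mktuple /q; case: cid => /= r /(congr1 (@^~ z)).
Qed.

(** * The generator preserves polynomials *)

Lemma is_derive_coord (R : realType) N (i j : 'I_N) (z : 'cV[R]_N) :
  is_derive z (delta_mx j 0) (fun z : 'cV[R]_N => z i 0) (i == j)%:R.
Proof.
have dq : (fun h : R =>
    h^-1 *: ((h *: delta_mx j 0 + z : 'cV[R]_N) i 0 - z i 0))
    @ 0^' --> ((i == j)%:R : R).
  (* The difference quotient is constant in h != 0. *)
  apply: cvg_near_cst; near=> h.
  rewrite !mxE eqxx andbT addrK scalerA mulVf ?scale1r//.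
  by near: h; exact: nbhs_dnbhs_neq.
by apply: DeriveDef; [apply: cvgP dq | apply: cvg_lim dq].
Unshelve. all: by end_near. Qed.

Lemma is_derive_poly_fun (R : realType) N (j : 'I_N) (p : mpoly N R) z :
  is_derive z (delta_mx j 0) (poly_fun p) (poly_fun (mderiv j p) z).
Proof.
(* The polynomials satisfying the claim form a subring that contains the
   constants and the variables, hence all polynomials. *)
pose Q p := is_derive z (delta_mx j 0) (poly_fun p) (poly_fun (mderiv j p) z).
have QC c : Q (mpolyC N c).
  rewrite /Q mderivC {2}/poly_fun meval0.
  rewrite [poly_fun _](_ : _ = cst c); first exact: is_derive_cst.
  by apply/funext => x; rewrite /poly_fun mevalC.
have QD p1 p2 : Q p1 -> Q p2 -> Q (p1 + p2).
  move=> h1 h2.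
  rewrite /Q [poly_fun (p1 + p2)](_ : _ = poly_fun p1 + poly_fun p2).
    apply: (is_derive_eq (is_deriveD h1 h2)).
    by rewrite mderivD /poly_fun mevalD.
  by apply/funext => x; rewrite /poly_fun mevalD.
have QM p1 p2 : Q p1 -> Q p2 -> Q (p1 * p2).
  move=> h1 h2.
  rewrite /Q [poly_fun (p1 * p2)](_ : _ = poly_fun p1 * poly_fun p2).
    apply: (is_derive_eq (is_deriveM h1 h2)).
    rewrite mderivM /poly_fun mevalD !mevalM addrC.
    by congr (_ + _); exact: mulrC.
  by apply/funext => x; rewrite /poly_fun mevalM.
have Q1 : Q 1 by rewrite -mpolyC1.
have QX i : Q (mpolyX R (mnm1 i)).
  rewrite /Q [poly_fun _](_ : _ = fun z : 'cV[R]_N => z i 0).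
    apply: (is_derive_eq (is_derive_coord i j z)).
    rewrite mderivX mnm1E /poly_fun mevalZ; have [->|_] := eqVneq i j.
      rewrite -{1}[mnm1 j]add0m addmK mevalX big1 ?mulr1// => k _.
      by rewrite mnm0E.
    by rewrite mul0r.
  by apply/funext => x; rewrite /poly_fun mevalXU.
elim/mpolyind: p => [|c m p _ _ Qp]; first by rewrite -(mpolyC0 N R); exact: QC.
apply: QD => //; rewrite -mul_mpolyC; apply: (QM) => //.
rewrite mpolyXE_id; apply: (big_ind Q Q1 QM) => i _.
by elim: (m i) => [|k IH]; rewrite ?expr0// exprS; exact: QM.
Qed.

Lemma partial_poly_fun (R : realType) N (j : 'I_N) (p : mpoly N R) :
  partial j (poly_fun p) = poly_fun (mderiv j p).
Proof.
apply/funext => z; have ? := is_derive_poly_fun j p z.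
by rewrite /partial derive_val.
Qed.

(** The drift term uses first formal derivatives of [psi], the diffusion term
    second ones, and the reset term the substitution of [reset S r] in [psi]. *)
Lemma generator_poly_fun (R : realType) N k nr (S : SHS R N k nr)
    (psi : mpoly N R) :
  polynomial_SHS S -> is_poly_fun (generator S (poly_fun psi)).
Proof.
move=> [driftP diffP intP resetP].
have E : generator S (poly_fun psi) = fun z =>
    \sum_i poly_fun (mderiv i psi) z * drift S z i 0 +
    2^-1 * (\sum_i \sum_j poly_fun (mderiv i (mderiv j psi)) z *
       \sum_l diffusion S z j l * diffusion S z i l) +
    \sum_r (poly_fun psi (reset S r z) - poly_fun psi z) * intensity S r z.
  apply/funext => z; rewrite /generator mxE; congr (_ + _ * _ + _).
    by apply: eq_bigr => i _; rewrite mxE partial_poly_fun.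
  apply: eq_bigr => i _; rewrite mxE; apply: eq_bigr => j _.
  rewrite !mxE !partial_poly_fun; congr (_ * _).
  by apply: eq_bigr => l _; rewrite mxE.
rewrite E; apply: is_poly_funD; last first.
  apply: is_poly_fun_sum => r; apply: is_poly_funM => //.
  apply: is_poly_funB; first exact: is_poly_fun_comp.
  exact: is_poly_fun_poly_fun.
apply: is_poly_funD.
  apply: is_poly_fun_sum => i; apply: is_poly_funM => //.
  exact: is_poly_fun_poly_fun.
apply: is_poly_funM; first exact: is_poly_fun_cst.
apply: is_poly_fun_sum => i; apply: is_poly_fun_sum => j.
apply: is_poly_funM; first exact: is_poly_fun_poly_fun.
by apply: is_poly_fun_sum => l; exact: is_poly_funM.
Qed.

(** * Expectations of polynomials as linear combinations of moments *)

Definition finite_moments (R : realType) N dT (T : measurableType dT)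
    (P : probability T R) (Y : T -> 'cV[R]_N) : Prop :=
  forall m, P.-integrable setT (fun w => (mono_fun m (Y w))%:E).

Lemma integrable_poly_fun (R : realType) N dT (T : measurableType dT)
    (P : probability T R) (Y : T -> 'cV[R]_N) (p : mpoly N R) :
  finite_moments P Y ->
  P.-integrable setT (fun w => (poly_fun p (Y w))%:E).
Proof.
move=> Yint; rewrite (_ : (fun w => _) = (fun w =>
    \sum_(m <- msupp p) (mcoeff m p)%:E * (mono_fun m (Y w))%:E)%E); last first.
  apply/funext => w; rewrite /poly_fun mevalE -sumEFin.
  by apply: eq_bigr => m _; rewrite EFinM.
by apply: integrable_sum => // m _; exact: integrableZl.
Qed.

Lemma expect_poly_funD (R : realType) N dT (T : measurableType dT)
    (P : probability T R) (Y : T -> 'cV[R]_N) (p q : mpoly N R) :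
  finite_moments P Y ->
  expect P (fun w => poly_fun (p + q) (Y w)) =
  expect P (fun w => poly_fun p (Y w)) + expect P (fun w => poly_fun q (Y w)).
Proof.
move=> Yint.
rewrite /expect unlock -RintegralD//; try exact: integrable_poly_fun.
by congr fine; apply: eq_integral => w _; rewrite /poly_fun mevalD.
Qed.

Lemma expect_poly_funZ (R : realType) N dT (T : measurableType dT)
    (P : probability T R) (Y : T -> 'cV[R]_N) c (p : mpoly N R) :
  finite_moments P Y ->
  expect P (fun w => poly_fun (c *: p) (Y w)) =
  c * expect P (fun w => poly_fun p (Y w)).
Proof.
move=> Yint.
rewrite /expect unlock -RintegralZl//; last exact: integrable_poly_fun.
by congr fine; apply: eq_integral => w _; rewrite /poly_fun mevalZ.
Qed.

Lemma expect_poly_fun_ae0 (R : realType) N dT (T : measurableType dT)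
    (P : probability T R) (Y : T -> 'cV[R]_N) (p : mpoly N R) :
  finite_moments P Y ->
  {ae P, forall w, poly_fun p (Y w) = 0} ->
  expect P (fun w => poly_fun p (Y w)) = 0.
Proof.
move=> Yint p0.
rewrite /expect unlock (@ae_eq_integral _ _ _ _ setT (cst 0%E))//.
- by rewrite integral0.
- exact: measurable_int (integrable_poly_fun p Yint).
- by apply: filterS p0 => w -> _.
Qed.

Lemma expect_poly_fun_sum (R : realType) N dT (T : measurableType dT)
    (P : probability T R) (Y : T -> 'cV[R]_N) I (s : seq I) (c : I -> R)
    (m : I -> multinom N) :
  finite_moments P Y ->
  expect P (fun w => poly_fun (\sum_(i <- s) c i *: mpolyX R (m i)) (Y w)) =
  \sum_(i <- s) c i * expect P (fun w => mono_fun (m i) (Y w)).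
Proof.
move=> Yint; elim: s => [|i s IH].
  rewrite !big_nil expect_poly_fun_ae0//.
  by apply: aeW => w; rewrite /poly_fun meval0.
by rewrite !big_cons expect_poly_funD// expect_poly_funZ// IH mono_funE.
Qed.

Lemma expect_row_poly (R : realType) N d q c (mbar : q.-tuple (multinom N))
    (C : 'M[R]_(c, low_dim N d)) (D : 'M[R]_(c, q)) (i : 'I_c)
    dT (T : measurableType dT) (P : probability T R)
    (z : R -> T -> 'cV[R]_N) t :
  finite_moments P (z t) ->
  expect P (fun w => poly_fun (row_poly mbar C D i) (z t w)) =
  (C *m low_moments d P z t + D *m moments_of mbar P z t) i 0.
Proof.
move=> zint; rewrite expect_poly_funD// !expect_poly_fun_sum// !mxE.
by congr (_ + _); apply: eq_bigr => a _; rewrite mxE.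
Qed.

(** * Polynomials as rows of coefficient matrices *)

Lemma low_exp_inj N d : injective (@low_exp N d).
Proof. by move=> a b /val_inj/enum_val_inj. Qed.

Lemma low_exp_surj N d m :
  (mdeg m <= d)%N -> exists a : 'I_(low_dim N d), low_exp a = m.
Proof.
rewrite -ltnS => md; exists (enum_rank (BMultinom md)).
by rewrite /low_exp enum_rankK.
Qed.

Lemma mdeg_low_exp N d (a : 'I_(low_dim N d)) : (mdeg (low_exp a) <= d)%N.
Proof. by rewrite -ltnS; exact: bmdeg. Qed.

(** Injectivity of [e] prevents the contributions of two indices to the same
    monomial from adding up. *)
Lemma mcoeff_sumX_inj (R : realType) N q (e : 'I_q -> multinom N)
    (f : multinom N -> R) m : injective e ->
  mcoeff m (\sum_a f (e a) *: mpolyX R (e a)) = f m *+ [exists a, e a == m].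
Proof.
move=> e_inj; rewrite raddf_sum /=.
case: existsP => [[a /eqP <-]|em].
  rewrite (bigD1 a)//= big1 ?addr0 => [|b ba]; rewrite mcoeffZ mcoeffX.
    by rewrite eqxx mulr1.
  by rewrite (inj_eq e_inj) (negbTE ba) mulr0.
rewrite big1// => a _; rewrite mcoeffZ mcoeffX.
case: eqP => [E|_]; last by rewrite mulr0.
by case: em; exists a; apply/eqP.
Qed.

Definition low_coefs (R : realType) N d c (p : 'I_c -> mpoly N R) :
    'M[R]_(c, low_dim N d) :=
  \matrix_(i, a) mcoeff (low_exp a) (p i).

Definition listed_coefs (R : realType) N q (mbar : q.-tuple (multinom N)) c
    (p : 'I_c -> mpoly N R) : 'M[R]_(c, q) :=
  \matrix_(i, b) mcoeff (tnth mbar b) (p i).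

(** Every monomial of an expressible polynomial is hit exactly once, either by
    a low exponent or by an entry of [mbar], because [mbar] has no repetition
    and no low exponent.  Hence coefficient extraction inverts [row_poly]. *)
Lemma row_poly_coefs (R : realType) N d q c (mbar : q.-tuple (multinom N))
    (p : 'I_c -> mpoly N R) i :
  uniq mbar -> (forall m, m \in mbar -> (d < mdeg m)%N) ->
  expressible d mbar (p i) ->
  row_poly mbar (low_coefs d p) (listed_coefs mbar p) i = p i.
Proof.
move=> mbar_uniq mbar_high p_expr; apply/mpolyP => m.
rewrite /row_poly mcoeffD.
under eq_bigr do rewrite mxE.
under [X in _ + mcoeff m X = _]eq_bigr do rewrite mxE.
rewrite (mcoeff_sumX_inj (e := @low_exp N d) (fun m' => mcoeff m' (p i)))//;
  last exact: low_exp_inj.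
rewrite (mcoeff_sumX_inj (e := tnth mbar) (fun m' => mcoeff m' (p i)));
  last exact/tuple_uniqP.
have -> : [exists b, tnth mbar b == m] = (m \in mbar).
  apply/existsP/idP => [[b /eqP<-]|/tnthP[b ->]]; first exact: mem_tnth.
  by exists b.
have -> : [exists a, @low_exp N d a == m] = (mdeg m <= d)%N.
  apply/existsP/idP => [[a /eqP<-]|/low_exp_surj[a <-]].
    exact: mdeg_low_exp.
  by exists a.
have [m_le|m_gt] := leqP (mdeg m) d.
  have /negbTE-> : m \notin mbar.
    by apply/negP => /mbar_high; rewrite ltnNge m_le.
  by rewrite addr0.
rewrite add0r; case: (boolP (m \in mbar)) => // m_mbar.
rewrite mulr0n; apply/esym/memN_msupp_eq0/negP => /p_expr[|//].
  by rewrite leqNgt m_gt.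
by move=> mm; rewrite mm in m_mbar.
Qed.

(** * The constraint relations form a finite linear system *)

Definition monomials_between N d D : seq (multinom N) :=
  [seq m <- [seq val m | m <- enum {: bmultinom N D.+1}] | (d < mdeg m)%N].

Lemma mem_monomials_between N d D m :
  (m \in monomials_between N d D) = (d < mdeg m <= D)%N.
Proof.
rewrite mem_filter; congr (_ && _); apply/mapP/idP => [[m' _ ->]|m_le].
  by rewrite -ltnS; exact: bmdeg.
by exists (BMultinom (m_le : (mdeg m < D.+1)%N)); rewrite ?mem_enum.
Qed.

Lemma uniq_monomials_between N d D : uniq (monomials_between N d D).
Proof. by rewrite filter_uniq// map_inj_uniq ?enum_uniq//; exact: val_inj. Qed.

Lemma expressible_monomials_between (R : realType) N d D (p : mpoly N R) :
  (forall m, m \in msupp p -> mdeg m <= D)%N ->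
  expressible d (in_tuple (monomials_between N d D)) p.
Proof.
move=> pD m /pD m_le; have [|md] := leqP (mdeg m) d; first by left.
by right; rewrite mem_monomials_between md.
Qed.

(** The rows are indexed by the pairs (j, m) with m of degree at most D whose
    multiple is expressible.  Restricting m loses nothing: when [a_p j 0] is
    nonzero, its leading monomial times m occurs in the multiple and bounds the
    degree of m, and when it is zero, all multiples coincide with the one for
    m = 0. *)
Lemma represents_relations_exists (R : realType) N d qp D
    (a_p : 'cV[mpoly N R]_qp) :
  (forall j, (d + msize (a_p j 0%R) <= D)%N) ->
  exists c (C : 'M[R]_(c, low_dim N d)) (E : 'M[R]_(c, _)),
    represents_relations a_p (in_tuple (monomials_between N d D)) C E.
Proof.
set mbar := in_tuple _ => a_pD.
have mbar_high m : m \in mbar -> (d < mdeg m)%N.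
  by rewrite mem_monomials_between => /andP[].
pose rel (x : 'I_qp * bmultinom N D.+1) := constraint_multiple a_p x.1 x.2.
pose A := [pred x | `[< expressible d mbar (rel x) >] ].
pose p (i : 'I_#|A|) := rel (enum_val i).
exists #|A|, (low_coefs d p), (listed_coefs mbar p).
have rowE i : row_poly mbar (low_coefs d p) (listed_coefs mbar p) i = p i.
  apply: row_poly_coefs => //; first exact: uniq_monomials_between.
  by apply: asboolW; have := enum_valP i; rewrite inE.
have multP j m m' : m' \in msupp (constraint_multiple a_p j m) ->
    exists2 l, l \in msupp (a_p j 0) & m' = mnm_add m l.
  by rewrite /constraint_multiple (perm_mem (msuppMX _ _)) => /mapP.
have rel_row x : expressible d mbar (rel x) -> exists i, p i = rel x.
  move=> /(@asboolT _) xA; exists (enum_rank_in (xA : x \in A) x).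
  by rewrite /p enum_rankK_in.
split => [i|j m e|j m /hasP[m' /multP[l l_supp ->] ml_le]].
- by rewrite rowE; eexists _, _; reflexivity.
- suff [x xE] : exists x, rel x = constraint_multiple a_p j m.
    by move: e; rewrite -xE => /rel_row[i <-]; exists i; rewrite rowE.
  have [a0|a_neq0] := eqVneq (a_p j 0) 0.
    by exists (j, bm0); rewrite /rel /constraint_multiple /= a0 !mul0r.
  suff mD : (mdeg m < D.+1)%N by exists (j, BMultinom mD).
  have l_supp := mlead_supp a_neq0.
  have /e : mnm_add m (mlead (a_p j 0)) \in msupp (constraint_multiple a_p j m).
    by rewrite (perm_mem (msuppMX _ _)) map_f.
  have dD : (d <= D)%N by exact: leq_trans (leq_addr _ _) (a_pD j).
  rewrite mem_monomials_between mdegD ltnS => -[|/andP[_]] le_mD.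
    by rewrite (leq_trans _ dD)// (leq_trans (leq_addr _ _) le_mD).
  exact: leq_trans (leq_addr _ _) le_mD.
- apply: expressible_monomials_between => _ /multP[l' l'_supp ->].
  rewrite mdegD (leq_trans _ (a_pD j))// leq_add//.
    by rewrite mdegD in ml_le; exact: leq_trans (leq_addr _ _) ml_le.
  exact/ltnW/msize_mdeg_lt.
Qed.

Theorem theorem2 (R : realType) (n L k nr : nat) (S : SHS R (n + L) k nr)
    (qn qp : nat) (a_n : 'cV[mpoly (n + L) R]_qn) (l_b u_b : 'cV[R]_qn)
    (a_p : 'cV[mpoly (n + L) R]_qp) (d : nat)
    (S_poly : polynomial_SHS S)
    (intensity_ge0 : forall r z, satisfies_constraints a_n l_b u_b a_p z ->
       0 <= intensity S r z) :
  exists (q : nat) (mbar : q.-tuple (multinom (n + L)))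
    (A : 'M[R]_(low_dim (n + L) d)) (B : 'M[R]_(low_dim (n + L) d, q))
    (c : nat) (Cp : 'M[R]_(c, low_dim (n + L) d)) (Dp : 'M[R]_(c, q)),
  [/\ uniq mbar,
      forall m, m \in mbar -> (d < mdeg m)%N,
      represents_relations a_p mbar Cp Dp
    & forall (dT : measure_display) (T : measurableType dT)
        (P : probability T R) (z : R -> T -> 'cV[R]_(n + L)),
      state_process S P z ->
      (forall t, 0 <= t ->
         {ae P, forall w, satisfies_constraints a_n l_b u_b a_p (z t w)}) ->
      forall t, 0 <= t ->
        (forall i, time_derivative (fun s => low_moments d P z s i 0) t
           ((A *m low_moments d P z t + B *m moments_of mbar P z t) i 0)) /\
        0 = Cp *m low_moments d P z t + Dp *m moments_of mbar P z t].
Proof.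
pose N := (n + L)%N.
have genP (a : 'I_(low_dim N d)) : exists g : mpoly N R,
    generator S (poly_fun (mpolyX R (low_exp a))) = poly_fun g.
  by have [g ->] := generator_poly_fun (mpolyX R (low_exp a)) S_poly; exists g.
pose g a := sval (cid (genP a)).
have gE a : generator S (poly_fun (mpolyX R (low_exp a))) = poly_fun (g a).
  by rewrite /g; case: cid.
(* One bound for both purposes: A and B, and the constraint relations. *)
pose D := (d + \max_j msize (a_p j 0%R) + \max_a msize (g a))%N.
have a_pD j : (d + msize (a_p j 0%R) <= D)%N.
  by rewrite (leq_trans _ (leq_addr _ _))// leq_add2l (leq_bigmax j).
have [c [Cp [Dp relP]]] := represents_relations_exists a_pD.
pose mbar := in_tuple (monomials_between N d D).
have mbar_high m : m \in mbar -> (d < mdeg m)%N.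
  by rewrite mem_monomials_between => /andP[].
have mbar_uniq : uniq mbar by exact: uniq_monomials_between.
exists _, mbar, (low_coefs d g), (listed_coefs mbar g), c, Cp, Dp.
split => // dT T P z [_ zint evolves] zcstr t t_ge0; split => [i|].
- rewrite -expect_row_poly; last exact: zint.
  rewrite row_poly_coefs//; last first.
    apply: expressible_monomials_between => m /msize_mdeg_lt/ltnW m_le.
    apply: leq_trans m_le _; apply: leq_trans (leq_addl _ _).
    exact: (leq_bigmax i).
  have := evolves (mpolyX R (low_exp i)) _ t_ge0.
  rewrite gE -mono_funE; congr (time_derivative _ _ _).
  by apply/funext => s; rewrite mxE.
- apply/colP => i; rewrite mxE -expect_row_poly; last exact: zint.
  have [/(_ i)[j [m ->]] _ _] := relP.
  rewrite expect_poly_fun_ae0//; first exact: zint.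
  apply: filterS (zcstr _ t_ge0) => w [_ /(_ j) a0].
  by rewrite /poly_fun mevalM [X in X * _]a0 mul0r.
Qed.
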